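(* There exist oriented matroids of rank $3$ on $13$ points whose realization spaces are disconnected.
   Context: Let $E=\{1,\dots,n\}$ and let $r\ge 1$ be an integer. An oriented matroid $\mathcal{M}=\mathcal{M}(E,\chi)$ of rank $r$ on $E$ (that is, on $n$ points) is defined by a map $\chi:E^r\to\{-1,0,+1\}$, called its chirotope, such that: (1) $\chi$ is not identically zero; (2) $\chi$ is alternating: $\chi(i_{\sigma(1)},\dots,i_{\sigma(r)})=\operatorname{sgn}(\sigma)\,\chi(i_1,\dots,i_r)$ for all $i_1,\dots,i_r\in E$ and all permutations $\sigma$ of $\{1,\dots,r\}$; (3) for all $i_1,\dots,i_r,j_1,\dots,j_r\in E$ such that $\chi(j_k,i_2,\dots,i_r)\cdot\chi(j_1,\dots,j_{k-1},i_1,j_{k+1},\dots,j_r)\ge 0$ for every $k=1,\dots,r$, we have $\chi(i_1,\dots,i_r)\cdot\chi(j_1,\dots,j_r)\ge 0$. For a real $r\times n$ matrix $X=(x_1,\dots,x_n)$ of rank $r$ with columns $x_i\in\mathbb{R}^r$, its chirotope is $\chi_X:E^r\to\{-1,0,+1\}$, $\chi_X(i_1,\dots,i_r)=\operatorname{sgn}\det(x_{i_1},\dots,x_{i_r})$. A realization of $\mathcal{M}(E,\chi)$ is a real $r\times n$ matrix $X$ of rank $r$ with $\chi_X=\chi$ or $\chi_X=-\chi$. Two realizations $X,X'$ are linearly equivalent if $X'=AX$ for some $A\in GL(r,\mathbb{R})$. The realization space $\mathcal{R}(\mathcal{M})$ is the set of all linear equivalence classes of realizations of $\mathcal{M}$,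 with the quotient topology induced from $\mathbb{R}^{rn}$ (the set of realizations carrying the subspace topology). *)

(* Defs.v *)
From HB Require Import structures.
From mathcomp Require Import all_boot all_order all_fingroup all_algebra.
From mathcomp Require Import generic_quotient.
From mathcomp Require Import all_classical all_reals all_analysis.

Set Implicit Arguments.
Unset Strict Implicit.
Unset Printing Implicit Defensive.

Import Order.TTheory GRing.Theory Num.Theory.
Import numFieldNormedType.Exports.

Local Open Scope classical_set_scope.
Local Open Scope ring_scope.

(* The ground set {1, ..., n} is 'I_n and an r-tuple (i_1, ..., i_r) of points
   is an element of {ffun 'I_r -> 'I_n}; both are indexed from 0. *)

Definition replace_at (r n : nat) (i : {ffun 'I_r -> 'I_n}) (k : 'I_r)
    (a : 'I_n) : {ffun 'I_r -> 'I_n} :=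
  [ffun l => if l == k then a else i l].

Record oriented_matroid (r n : nat) := OrientedMatroid {
  chirotope :> {ffun 'I_r -> 'I_n} -> int ;
  rank_gt0 : (0 < r)%N ;
  chirotope_sign : forall i, chirotope i \in [:: -1; 0; 1] ;
  chirotope_neq0 : exists i, chirotope i != 0 ;
  chirotope_alternating : forall (s : 'S_r) (i : {ffun 'I_r -> 'I_n}),
    chirotope [ffun k => i (s k)] = (-1) ^+ s * chirotope i ;
  chirotope_exchange : forall i j : {ffun 'I_r -> 'I_n},
    let first := Ordinal rank_gt0 in
    (forall k : 'I_r, 0 <= chirotope (replace_at i first (j k)) *
                           chirotope (replace_at j k (i first))) ->
    0 <= chirotope i * chirotope j
}.

Definition chirotope_mx (R : realType) (r n : nat) (X : 'M[R]_(r, n))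
    (i : {ffun 'I_r -> 'I_n}) : int :=
  sgz (\det (colsub i X)).

Definition realizations (R : realType) (r n : nat) (M : oriented_matroid r n) :
    set 'M[R]_(r, n) :=
  [set X | \rank X = r /\
    (chirotope_mx X =1 M \/ chirotope_mx X =1 (fun i => - M i))].
Arguments realizations R {r n} M.

Definition linearly_equivalent (R : realType) (r n : nat)
    (M : oriented_matroid r n) (X Y : realizations R M) : bool :=
  `[< exists2 A : 'M[R]_r, A \in unitmx & \val Y = A *m \val X >].

Lemma linearly_equivalent_refl (R : realType) (r n : nat)
    (M : oriented_matroid r n) : reflexive (@linearly_equivalent R r n M).
Proof.
by move=> X; apply/asboolP; exists 1%:M; rewrite ?unitmx1 ?mul1mx.
Qed.

Lemma linearly_equivalent_sym (R : realType) (r n : nat)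
    (M : oriented_matroid r n) : symmetric (@linearly_equivalent R r n M).
Proof.
suff sub (X Y : realizations R M) :
    linearly_equivalent X Y -> linearly_equivalent Y X.
  by move=> X Y; apply/idP/idP; exact: sub.
move=> /asboolP[A uA YE]; apply/asboolP; exists (invmx A).
  by rewrite unitmx_inv.
by rewrite YE mulKmx.
Qed.

Lemma linearly_equivalent_trans (R : realType) (r n : nat)
    (M : oriented_matroid r n) : transitive (@linearly_equivalent R r n M).
Proof.
move=> Y X Z /asboolP[A uA YE] /asboolP[B uB ZE]; apply/asboolP.
by exists (B *m A); rewrite ?unitmx_mul ?uA ?uB // ZE YE mulmxA.
Qed.

Definition linear_equivalence (R : realType) (r n : nat)
    (M : oriented_matroid r n) : equiv_rel (realizations R M) :=
  EquivRel _ (@linearly_equivalent_refl R r n M)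
    (@linearly_equivalent_sym R r n M) (@linearly_equivalent_trans R r n M).

(* The type of realizations carries the subspace topology of 'M[R]_(r, n). *)
Definition realization_space (R : realType) (r n : nat)
    (M : oriented_matroid r n) : topologicalType :=
  quotient_topology {eq_quot linear_equivalence R M}%qT.

(* Main.v *)
Require Import Defs.
From mathcomp Require Import all_boot all_order all_fingroup all_algebra.
From mathcomp Require Import generic_quotient.
From mathcomp Require Import all_classical all_reals all_analysis.
From Stdlib Require Import ZArith.
From mathcomp Require Import ring ssrZ.

Set Implicit Arguments.
Unset Strict Implicit.
Unset Printing Implicit Defensive.

Import Order.TTheory GRing.Theory Num.Theory.
Import numFieldNormedType.Exports.

Local Open Scope classical_set_scope.
Local Open Scope ring_scope.

(* Take the projective frame 0, 1, 2, 3 = e1, e2, e3, (1, 1, 1), the points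
     4 = (1, 1, 1 + s), 5 = (1, 1 + u, 1), 6 = (1, 1, 1 + t),
     7 = (1 + v, 1, 1 + t),
   and the intersection points 8 of the lines 56 and 27, 9 of 48 and 02,
   10 of 59 and 27, 11 of 48 and 01, 12 of 3(10) and 7(11).
   Up to nonvanishing factors, det(1, 4, 12) equals
     ((1 + s)(1 + u)tv - u(s - t))
     (u(s - t) - u^2(1 + t)(1 + v) - v(2ut + t + u)),
   where neither factor is a product of determinants of the configuration.
   So if the oriented matroid prescribes the incidences and a nonzero value of
   chi(1, 4, 12), then the first factor has no zero on the realization space,
   and it suffices to exhibit two realizations where it has opposite signs. *)

(** * Brackets, Cramer's rule and projective frames *)

Definition bracket (R : pzRingType) n (X : 'M[R]_(3, n)) (a b c : 'I_n) : R :=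
  X 0 a * (X 1 b * X 2 c - X 2 b * X 1 c)
  - X 1 a * (X 0 b * X 2 c - X 2 b * X 0 c)
  + X 2 a * (X 0 b * X 1 c - X 1 b * X 0 c).

Lemma det_colsub3 (R : comNzRingType) n (X : 'M[R]_(3, n)) (i : 'I_3 -> 'I_n) :
  \det (colsub i X) = bracket X (i 0) (i 1) (i 2).
Proof.
(* Indexing the entries by naturals lets [ring] see equal ordinals with different proofs as one
   atom. *)
have [g gE] : exists g : nat -> nat -> R, forall r k : 'I_3, X r (i k) = g r k.
  by exists (fun r k => X (inord r) (i (inord k))) => r k; rewrite !inord_val.
rewrite (expand_det_row _ 0) !big_ord_recl big_ord0 /cofactor.
rewrite !(expand_det_row _ 0) !big_ord_recl !big_ord0 /cofactor !det_mx11 !mxE.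
rewrite /bracket !gE /= /bump /=.
by rewrite !(add0n, addn0, addn1, expr0, expr1, sqrrN, expr1n); ring.
Qed.

(** Cramer's rule expands the column [a], times [bracket X x y z], in the columns [x], [y], [z]; the
    three summands are the products in the exchange axiom. *)
Lemma grassmann_pluecker3 (R : comPzRingType) n (X : 'M[R]_(3, n))
    (a b c x y z : 'I_n) :
  bracket X a b c * bracket X x y z =
    bracket X x b c * bracket X a y z + bracket X y b c * bracket X x a z
    + bracket X z b c * bracket X x y a.
Proof. by rewrite /bracket; ring. Qed.

Lemma bracket_mulmx (R : comNzRingType) n (A : 'M[R]_3) (X : 'M[R]_(3, n))
    (a b c : 'I_n) : bracket (A *m X) a b c = \det A * bracket X a b c.
Proof.
pose i (k : 'I_3) := nth a [:: a; b; c] k.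
have e : bracket X a b c = \det (colsub i X) by rewrite det_colsub3.
by rewrite e -det_mulmx mulmx_colsub det_colsub3.
Qed.

Lemma mxrank_bracket (F : fieldType) n (X : 'M[F]_(3, n)) a b c :
  bracket X a b c != 0 -> \rank X = 3.
Proof.
pose i (k : 'I_3) := nth a [:: a; b; c] k => abc.
have i_unit : colsub i X \in unitmx by rewrite unitmxE unitfE det_colsub3.
have := mxrankM_maxl X (colsub i 1%:M).
rewrite mulmx_colsub mulmx1 mxrank_unit // => rank_ge3.
by apply/eqP; rewrite eqn_leq rank_leq_row.
Qed.

(* Cramer's rule for the intersection point [x] of the lines [a b] and [c d];
   the column [e] only certifies that [c] and [d] are distinct points. *)
Lemma meet_column (F : fieldType) n (X : 'M[F]_(3, n)) (a b c d e x : 'I_n) :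
  bracket X a b x = 0 -> bracket X c d x = 0 ->
  bracket X a b d != 0 -> bracket X c d e != 0 ->
  exists k, forall r,
    X r x = k * (bracket X a b d * X r c - bracket X a b c * X r d).
Proof.
move=> abx cdx abd cde.
exists (bracket X x d e / (bracket X c d e * bracket X a b d)) => r.
(* An identity in arbitrary columns; the two incidences kill its last two summands. *)
have cramer : bracket X c d e * bracket X a b d * X r x =
    bracket X x d e * (bracket X a b d * X r c - bracket X a b c * X r d)
    + bracket X a b d * bracket X c d x * X r e
    + X r d * (bracket X a b x * bracket X c d e
               - bracket X a b e * bracket X c d x).
  case: r => [[|[|[|r]]] lt_r3] //;
  [have -> : Ordinal lt_r3 = 0 by exact: val_inj
  |have -> : Ordinal lt_r3 = 1 by exact: val_inj
  |have -> : Ordinal lt_r3 = 2 by exact: val_inj]; rewrite /bracket; ring.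
rewrite abx cdx !(mulr0, mul0r, subr0, addr0) in cramer.
by rewrite mulrAC -cramer mulrC mulKf // mulf_neq0.
Qed.

(** Inverting the columns [i], [j], [k] turns them into unit vectors. The other three brackets make
    all coordinates of [l] nonzero, so a diagonal scaling then sends [l] to (1, 1, 1) and leaves
    multiples of the unit vectors. *)
Lemma frame_normal_form (F : fieldType) n (X : 'M[F]_(3, n)) (i j k l : 'I_n) :
  bracket X i j k != 0 -> bracket X l j k != 0 -> bracket X i l k != 0 ->
  bracket X i j l != 0 ->
  exists2 A : 'M[F]_3, A \in unitmx & exists2 abc : F * F * F,
    [/\ abc.1.1 != 0, abc.1.2 != 0 & abc.2 != 0] &
    [/\ [/\ (A *m X) 0 i = abc.1.1, (A *m X) 1 i = 0 & (A *m X) 2 i = 0],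
        [/\ (A *m X) 0 j = 0, (A *m X) 1 j = abc.1.2 & (A *m X) 2 j = 0],
        [/\ (A *m X) 0 k = 0, (A *m X) 1 k = 0 & (A *m X) 2 k = abc.2] &
        [/\ (A *m X) 0 l = 1, (A *m X) 1 l = 1 & (A *m X) 2 l = 1]].
Proof.
move=> ijk ljk ilk ijl.
pose frame (m : 'I_3) : 'I_n := nth i [:: i; j; k] m.
have frame_unit : colsub frame X \in unitmx.
  by rewrite unitmxE unitfE det_colsub3.
pose Y := invmx (colsub frame X) *m X.
have Y_frame r m : Y r (frame m) = (r == m)%:R.
  have : colsub frame Y = 1%:M by rewrite -mulmx_colsub mulVmx.
  by move/matrixP/(_ r m); rewrite !mxE.
have bracketY x y z : bracket X x y z != 0 -> bracket Y x y z != 0.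
  by move=> ?; rewrite bracket_mulmx mulf_neq0 // det_inv invr_neq0 // -unitfE.
have Yi r : Y r i = (r == 0)%:R by exact: (Y_frame r 0).
have Yj r : Y r j = (r == 1)%:R by exact: (Y_frame r 1).
have Yk r : Y r k = (r == 2)%:R by exact: (Y_frame r 2).
have Y0 : Y 0 l != 0.
  move: (bracketY _ _ _ ljk); rewrite /bracket !(Yj, Yk) /=.
  by rewrite !(mulr0, mulr1, subr0, addr0).
have Y1 : Y 1 l != 0.
  move: (bracketY _ _ _ ilk); rewrite /bracket !(Yi, Yk) /=.
  by rewrite !(mulr0, mulr1, mul0r, mul1r, subr0, addr0).
have Y2 : Y 2 l != 0.
  move: (bracketY _ _ _ ijl); rewrite /bracket !(Yi, Yj) /=.
  by rewrite !(mulr0, mulr1, mul0r, mul1r, subr0, addr0).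
pose d := \row_r (Y r l)^-1.
exists (diag_mx d *m invmx (colsub frame X)).
  rewrite unitmx_mul unitmx_inv frame_unit andbT unitmxE det_diag unitfE.
  apply/prodf_neq0 => r _; rewrite mxE invr_neq0 //.
  by case: r => [[|[|[|r]]] lt_r3] //; [move: Y0|move: Y1|move: Y2];
    apply: contra_neq => <-; congr (Y _ l); exact: val_inj.
have AXE r m :
    (diag_mx d *m invmx (colsub frame X) *m X) r m = (Y r l)^-1 * Y r m.
  by rewrite -mulmxA mul_diag_mx !mxE.
exists ((Y 0 l)^-1, (Y 1 l)^-1, (Y 2 l)^-1); first by rewrite !invr_eq0.
by rewrite !AXE !(Yi, Yj, Yk) /= !mulr1 !mulr0 !mulVf.
Qed.

(** * Chirotopes of real matrices *)

Lemma chirotope_mxE (R : realType) n (X : 'M[R]_(3, n)) i :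
  chirotope_mx X i = sgz (bracket X (i 0) (i 1) (i 2)).
Proof. by rewrite /chirotope_mx det_colsub3. Qed.

Lemma chirotope_mx_sign (R : realType) n (X : 'M[R]_(3, n)) i :
  chirotope_mx X i \in [:: -1; 0; 1].
Proof. by rewrite /chirotope_mx; case: sgzP. Qed.

Lemma chirotope_mx_alternating (R : realType) n (X : 'M[R]_(3, n)) (s : 'S_3)
    (i : {ffun 'I_3 -> 'I_n}) :
  chirotope_mx X [ffun k => i (s k)] = (-1) ^+ s * chirotope_mx X i.
Proof.
have -> : chirotope_mx X [ffun k => i (s k)] =
    sgz (\det (col_perm s (colsub i X))).
  by congr (sgz (\det _)); apply/matrixP => a b; rewrite !mxE ffunE.
by rewrite col_permE det_mulmx det_perm odd_permV sgzM mulrC sgzX sgzN1.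
Qed.

(** The index [o] is kept abstract because the first index in the axiom carries its own proof of
    positivity. *)
Lemma chirotope_mx_exchange (R : realType) n (X : 'M[R]_(3, n))
    (i j : {ffun 'I_3 -> 'I_n}) (o : 'I_3) :
  o = 0 ->
  (forall k : 'I_3, 0 <= chirotope_mx X (replace_at i o (j k)) *
                         chirotope_mx X (replace_at j k (i o))) ->
  0 <= chirotope_mx X i * chirotope_mx X j.
Proof.
move=> -> exch; have := exch 2; have := exch 1; have := exch 0.
rewrite !chirotope_mxE !ffunE /= -!sgzM !sgz_ge0 => h0 h1 h2.
by rewrite grassmann_pluecker3 !addr_ge0.
Qed.

(** Kept transparent so that its chirotope unfolds to [chirotope_mx X]. *)
Definition vector_matroid (R : realType) n (X : 'M[R]_(3, n))
    (X_neq0 : exists i, chirotope_mx X i != 0) : oriented_matroid 3 n.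
Proof.
refine (@OrientedMatroid 3 n (chirotope_mx X) isT (chirotope_mx_sign X)
  X_neq0 (@chirotope_mx_alternating R n X) _).
move=> i j first; apply: chirotope_mx_exchange; exact: val_inj.
Defined.

(** * The configuration *)

Local Notation "'p_ k" := (@Ordinal 13 k isT)
  (at level 8, k at level 2, format "''p_' k").

Definition incidences : seq ('I_13 * 'I_13 * 'I_13) :=
  [:: ('p_2, 'p_3, 'p_4); ('p_1, 'p_3, 'p_5); ('p_2, 'p_3, 'p_6);
      ('p_0, 'p_6, 'p_7); ('p_5, 'p_6, 'p_8); ('p_2, 'p_7, 'p_8);
      ('p_4, 'p_8, 'p_9); ('p_0, 'p_2, 'p_9); ('p_5, 'p_9, 'p_10);
      ('p_2, 'p_7, 'p_10); ('p_4, 'p_8, 'p_11); ('p_0, 'p_1, 'p_11);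
      ('p_3, 'p_10, 'p_12); ('p_7, 'p_11, 'p_12)].

(* All triples but the last one only ensure that the successive points of the
   construction are well defined. *)
Definition bases : seq ('I_13 * 'I_13 * 'I_13) :=
  [:: ('p_0, 'p_1, 'p_2); ('p_3, 'p_1, 'p_2); ('p_0, 'p_3, 'p_2);
      ('p_0, 'p_1, 'p_3); ('p_4, 'p_1, 'p_2); ('p_5, 'p_1, 'p_2);
      ('p_6, 'p_1, 'p_2); ('p_0, 'p_7, 'p_2); ('p_5, 'p_6, 'p_7);
      ('p_2, 'p_7, 'p_0); ('p_4, 'p_8, 'p_2); ('p_0, 'p_2, 'p_1);
      ('p_5, 'p_9, 'p_7); ('p_4, 'p_8, 'p_1); ('p_3, 'p_10, 'p_11);
      ('p_7, 'p_11, 'p_0); ('p_1, 'p_4, 'p_12)].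

(* The point [i] has coordinates [(x i : y i : z i)] in the projective frame
   0, 1, 2, 3, so that s = z4/x4 - 1, u = y5/x5 - 1, t = z6/x6 - 1 and
   v = x7/y7 - 1; this is the factor (1 + s)(1 + u)tv - u(s - t) after clearing
   denominators. *)
Definition separator_of (R : pzRingType)
    (br : 'I_13 -> 'I_13 -> 'I_13 -> R) : R :=
  let x i := br i 'p_1 'p_2 * br 'p_0 'p_3 'p_2 * br 'p_0 'p_1 'p_3 in
  let y i := br 'p_3 'p_1 'p_2 * br 'p_0 i 'p_2 * br 'p_0 'p_1 'p_3 in
  let z i := br 'p_3 'p_1 'p_2 * br 'p_0 'p_3 'p_2 * br 'p_0 'p_1 i in
  z 'p_4 * y 'p_5 * (z 'p_6 - x 'p_6) * (x 'p_7 - y 'p_7)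
  - (y 'p_5 - x 'p_5) * y 'p_7
    * ((z 'p_4 - x 'p_4) * x 'p_6 - x 'p_4 * (z 'p_6 - x 'p_6)).

Definition separator (R : pzRingType) (X : 'M[R]_(3, 13)) : R :=
  separator_of (bracket X).

Lemma separator_of_rmorph (R S : pzRingType) (f : {rmorphism R -> S})
    (br : 'I_13 -> 'I_13 -> 'I_13 -> R) :
  separator_of (fun i j k => f (br i j k)) = f (separator_of br).
Proof. by rewrite /separator_of !(rmorphB, rmorphM). Qed.

(** Each monomial is a product of 12 brackets. As 12 is even, an invertible [A] over an ordered
    field preserves the sign even when [\det A] is negative. *)
Lemma separator_mulmx (R : comNzRingType) (A : 'M[R]_3) (X : 'M[R]_(3, 13)) :
  separator (A *m X) = (\det A) ^+ 12 * separator X.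
Proof. by rewrite /separator /separator_of !bracket_mulmx; ring. Qed.

(** The points 8 to 12 are computed in turn as intersections. Their scalars may be arbitrary: it
    suffices that a zero of the first factor would make the bracket of 1, 4, 12 vanish. *)
Lemma separator_normal_neq0 (F : fieldType) (X : 'M[F]_(3, 13))
    (a b c s t u v p4 p5 p6 p7 : F) :
  a * b * c * (p4 * p5 * p6 * p7) != 0 ->
  [/\ X 0 'p_0 = a, X 1 'p_0 = 0 & X 2 'p_0 = 0] ->
  [/\ X 0 'p_1 = 0, X 1 'p_1 = b & X 2 'p_1 = 0] ->
  [/\ X 0 'p_2 = 0, X 1 'p_2 = 0 & X 2 'p_2 = c] ->
  [/\ X 0 'p_3 = 1, X 1 'p_3 = 1 & X 2 'p_3 = 1] ->
  [/\ X 0 'p_4 = p4, X 1 'p_4 = p4 & X 2 'p_4 = p4 * (1 + s)] ->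
  [/\ X 0 'p_5 = p5, X 1 'p_5 = p5 * (1 + u) & X 2 'p_5 = p5] ->
  [/\ X 0 'p_6 = p6, X 1 'p_6 = p6 & X 2 'p_6 = p6 * (1 + t)] ->
  [/\ X 0 'p_7 = p7 * (1 + v), X 1 'p_7 = p7 & X 2 'p_7 = p7 * (1 + t)] ->
  (forall T, T \in incidences -> bracket X T.1.1 T.1.2 T.2 = 0) ->
  (forall T, T \in bases -> bracket X T.1.1 T.1.2 T.2 != 0) ->
  separator X != 0.
Proof.
move=> scale_neq0 [X00 X10 X20] [X01 X11 X21] [X02 X12 X22] [X03 X13 X23].
move=> [X04 X14 X24] [X05 X15 X25] [X06 X16 X26] [X07 X17 X27] inc bas.
have z i j k : (i, j, k) \in incidences -> bracket X i j k = 0 by exact: inc.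
have nz i j k : (i, j, k) \in bases -> bracket X i j k != 0 by exact: bas.
have [k8 X_8] := meet_column (z 'p_5 'p_6 'p_8 isT) (z 'p_2 'p_7 'p_8 isT)
  (nz 'p_5 'p_6 'p_7 isT) (nz 'p_2 'p_7 'p_0 isT).
have [k9 X_9] := meet_column (z 'p_4 'p_8 'p_9 isT) (z 'p_0 'p_2 'p_9 isT)
  (nz 'p_4 'p_8 'p_2 isT) (nz 'p_0 'p_2 'p_1 isT).
have [k10 X_10] := meet_column (z 'p_5 'p_9 'p_10 isT) (z 'p_2 'p_7 'p_10 isT)
  (nz 'p_5 'p_9 'p_7 isT) (nz 'p_2 'p_7 'p_0 isT).
have [k11 X_11] := meet_column (z 'p_4 'p_8 'p_11 isT) (z 'p_0 'p_1 'p_11 isT)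
  (nz 'p_4 'p_8 'p_1 isT) (nz 'p_0 'p_1 'p_2 isT).
have [k12 X_12] := meet_column (z 'p_3 'p_10 'p_12 isT) (z 'p_7 'p_11 'p_12 isT)
  (nz 'p_3 'p_10 'p_11 isT) (nz 'p_7 'p_11 'p_0 isT).
(* Here and below, common factors of the Cramer coordinates are absorbed into the scalar, which
   keeps later polynomials small. *)
have {k8 X_8} [q8 [X08 X18 X28]] : exists q8,
    [/\ X 0 'p_8 = q8 * (u * (1 + v)), X 1 'p_8 = q8 * u &
        X 2 'p_8 = q8 * (u * (1 + t) * (1 + v) + t * v)].
  exists (k8 * p5 * p6 * p7 * c); split; rewrite X_8 /bracket
    ?(X02, X12, X22, X05, X15, X25, X06, X16, X26, X07, X17, X27); ring.
pose w := u * (s - t) - (u * t + u + t) * v.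
have {k9 X_9} [q9 [X09 X19 X29]] : exists q9,
    [/\ X 0 'p_9 = - (q9 * (u * v)), X 1 'p_9 = 0 & X 2 'p_9 = q9 * w].
  exists (k9 * p4 * q8 * a * c); split; rewrite X_9 /bracket /w
    ?(X00, X10, X20, X02, X12, X22, X04, X14, X24, X08, X18, X28); ring.
have {k10 X_10} [q10 [X010 X110 X210]] : exists q10,
    [/\ X 0 'p_10 = q10 * (u * v * (1 + u) * (1 + v)),
        X 1 'p_10 = q10 * (u * v * (1 + u)) &
        X 2 'p_10 = q10 * (u * v - (u + v + u * v) * w)].
  exists (- (k10 * p5 * q9 * p7 * c)); split; rewrite X_10 /bracket
    ?(X02, X12, X22, X05, X15, X25, X07, X17, X27, X09, X19, X29); ring.
have {k11 X_11} [q11 [X011 X111 X211]] : exists q11,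
    [/\ X 0 'p_11 = q11 * (w + u * v * (1 + s)), X 1 'p_11 = q11 * w &
        X 2 'p_11 = 0].
  exists (k11 * p4 * q8 * a * b); split; rewrite X_11 /bracket /w
    ?(X00, X10, X20, X01, X11, X21, X04, X14, X24, X08, X18, X28); ring.
have bracket_1_4_12 : bracket X 'p_1 'p_4 'p_12 =
    - (k12 * b * p4 * p7 * q10 * q11) * v ^+ 2
    * ((1 + s) * (1 + u) * t * v - u * (s - t))
    * (u * (s - t) - u ^+ 2 * (1 + t) * (1 + v) - v * (2 * u * t + t + u)).
  rewrite /bracket !X_12 /bracket ?(X01, X11, X21, X03, X13, X23, X04, X14, X24,
    X07, X17, X27, X010, X110, X210, X011, X111, X211) /w; ring.
have separatorE : separator X = (a * b * c) ^+ 8 * (p4 * p5 * p6 * p7)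
    * ((1 + s) * (1 + u) * t * v - u * (s - t)).
  rewrite /separator /separator_of /bracket ?(X00, X10, X20, X01, X11, X21, X02,
    X12, X22, X03, X13, X23, X04, X14, X24, X05, X15, X25, X06, X16, X26, X07,
    X17, X27); ring.
have scale8_neq0 : (a * b * c) ^+ 8 * (p4 * p5 * p6 * p7) != 0.
  move: scale_neq0; rewrite mulf_eq0 negb_or => /andP[? ?].
  by rewrite mulf_neq0 // expf_neq0.
rewrite separatorE mulf_neq0 //.
apply: contra_neq (nz 'p_1 'p_4 'p_12 isT) => factor0.
by rewrite bracket_1_4_12 factor0 mulr0 mul0r.
Qed.

(** Normalizing the frame multiplies all brackets and the separator by powers of a nonzero
    determinant, so it reduces the claim to explicit coordinates. *)
Lemma separator_neq0 (F : fieldType) (X : 'M[F]_(3, 13)) :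
  (forall T, T \in incidences -> bracket X T.1.1 T.1.2 T.2 = 0) ->
  (forall T, T \in bases -> bracket X T.1.1 T.1.2 T.2 != 0) ->
  separator X != 0.
Proof.
move=> incX basX.
have [A unitA [[[a b] c] /= [a0 b0 c0] [Y_0 Y_1 Y_2 Y_3]]] := frame_normal_form
  (basX ('p_0, 'p_1, 'p_2) isT) (basX ('p_3, 'p_1, 'p_2) isT)
  (basX ('p_0, 'p_3, 'p_2) isT) (basX ('p_0, 'p_1, 'p_3) isT).
have detA : \det A != 0 by rewrite -unitfE -unitmxE.
move: Y_0 Y_1 Y_2 Y_3; set Y := A *m X => Y_0 Y_1 Y_2 Y_3.
suff: separator Y != 0.
  by rewrite separator_mulmx mulf_eq0 negb_or => /andP[].
have inc T : T \in incidences -> bracket Y T.1.1 T.1.2 T.2 = 0.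
  by move=> /incX X_T; rewrite bracket_mulmx X_T mulr0.
have bas T : T \in bases -> bracket Y T.1.1 T.1.2 T.2 != 0.
  by move=> /basX X_T; rewrite bracket_mulmx mulf_neq0.
have [[Y00 Y10 Y20] [Y01 Y11 Y21] [Y02 Y12 Y22] [Y03 Y13 Y23]] :=
  And4 Y_0 Y_1 Y_2 Y_3.
have Y04 : Y 0 'p_4 != 0.
  have := bas ('p_4, 'p_1, 'p_2) isT.
  rewrite /bracket /= !(Y01, Y11, Y21, Y02, Y12, Y22).
  by apply: contra_neq => ->; ring.
have Y05 : Y 0 'p_5 != 0.
  have := bas ('p_5, 'p_1, 'p_2) isT.
  rewrite /bracket /= !(Y01, Y11, Y21, Y02, Y12, Y22).
  by apply: contra_neq => ->; ring.
have Y06 : Y 0 'p_6 != 0.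
  have := bas ('p_6, 'p_1, 'p_2) isT.
  rewrite /bracket /= !(Y01, Y11, Y21, Y02, Y12, Y22).
  by apply: contra_neq => ->; ring.
have Y17 : Y 1 'p_7 != 0.
  have := bas ('p_0, 'p_7, 'p_2) isT.
  rewrite /bracket /= !(Y00, Y10, Y20, Y02, Y12, Y22).
  by apply: contra_neq => ->; ring.
(* Expanding an incidence along frame columns and cancelling a frame scaling relates coordinates;
   the last relation, [Y27], gives 6 and 7 the same parameter t. *)
have Y14 : Y 1 'p_4 = Y 0 'p_4.
  apply: (mulfI c0); apply/eqP; rewrite -subr_eq0; apply/eqP.
  rewrite -(inc ('p_2, 'p_3, 'p_4) isT).
  by rewrite /bracket /= !(Y02, Y12, Y22, Y03, Y13, Y23); ring.
have Y16 : Y 1 'p_6 = Y 0 'p_6.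
  apply: (mulfI c0); apply/eqP; rewrite -subr_eq0; apply/eqP.
  rewrite -(inc ('p_2, 'p_3, 'p_6) isT).
  by rewrite /bracket /= !(Y02, Y12, Y22, Y03, Y13, Y23); ring.
have Y25 : Y 2 'p_5 = Y 0 'p_5.
  apply: (mulfI b0); apply/eqP; rewrite eq_sym -subr_eq0; apply/eqP.
  rewrite -(inc ('p_1, 'p_3, 'p_5) isT).
  by rewrite /bracket /= !(Y01, Y11, Y21, Y03, Y13, Y23); ring.
have Y27 : Y 0 'p_6 * Y 2 'p_7 = Y 1 'p_7 * Y 2 'p_6.
  apply: (mulfI a0); apply/eqP; rewrite -subr_eq0; apply/eqP.
  rewrite -(inc ('p_0, 'p_6, 'p_7) isT).
  by rewrite /bracket /= !(Y00, Y10, Y20, Y16); ring.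
have ratioK x y : x != 0 -> x * (1 + (y / x - 1)) = y :> F.
  by move=> x0; field.
apply: (@separator_normal_neq0 _ _ a b c
  (Y 2 'p_4 / Y 0 'p_4 - 1) (Y 2 'p_6 / Y 0 'p_6 - 1)
  (Y 1 'p_5 / Y 0 'p_5 - 1) (Y 0 'p_7 / Y 1 'p_7 - 1)
  (Y 0 'p_4) (Y 0 'p_5) (Y 0 'p_6) (Y 1 'p_7));
  rewrite ?ratioK ?mulf_neq0 //.
by split=> //; apply: (mulfI Y06); rewrite Y27; field; exact: Y06.
Qed.

(** * Topology of the realization space *)

Lemma continuous_add (R : realType) (T : topologicalType) (f g : T -> R) :
  continuous f -> continuous g -> continuous (fun x => f x + g x).
Proof. by move=> fc gc x; apply: cvgD; [exact: fc|exact: gc]. Qed.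

Lemma continuous_sub (R : realType) (T : topologicalType) (f g : T -> R) :
  continuous f -> continuous g -> continuous (fun x => f x - g x).
Proof. by move=> fc gc x; apply: cvgB; [exact: fc|exact: gc]. Qed.

Lemma continuous_mul (R : realType) (T : topologicalType) (f g : T -> R) :
  continuous f -> continuous g -> continuous (fun x => f x * g x).
Proof. by move=> fc gc x; apply: cvgM; [exact: fc|exact: gc]. Qed.

Lemma continuous_bracket (R : realType) n (a b c : 'I_n) :
  continuous (fun X : 'M[R]_(3, n) => bracket X a b c).
Proof.
have coord r j : continuous (fun X : 'M[R]_(3, n) => X r j).
  exact: coord_continuous.
have minor r r' :
    continuous (fun X : 'M[R]_(3, n) => X r b * X r' c - X r' b * X r c).
  by apply: continuous_sub; apply: continuous_mul.
by apply: continuous_add; [apply: continuous_sub|]; apply: continuous_mul.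
Qed.

Lemma continuous_separator (R : realType) :
  continuous (@separator R : 'M[R]_(3, 13) -> R).
Proof.
have br i j k := @continuous_bracket R 13 i j k.
have br3 i j k i' j' k' i'' j'' k'' : continuous (fun X : 'M[R]_(3, 13) =>
    bracket X i j k * bracket X i' j' k' * bracket X i'' j'' k'').
  by apply: continuous_mul => //; apply: continuous_mul.
rewrite /separator /separator_of; apply: continuous_sub.
  apply: continuous_mul; last exact: continuous_sub.
  by apply: continuous_mul; [apply: continuous_mul|apply: continuous_sub].
apply: continuous_mul; first by apply: continuous_mul => //; apply: continuous_sub.
by apply: continuous_sub; apply: continuous_mul => //; apply: continuous_sub.
Qed.

(** Positivity of [phi] is constant on linear equivalence classes, and since [phi] never vanishes
    the remaining classes are those where it is negative. Both sets are open, so the first is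
    clopen; it contains the class of [X1] and misses that of [X2]. *)
Lemma realization_space_disconnected (R : realType) (r n : nat)
    (M : oriented_matroid r n) (phi : 'M[R]_(r, n) -> R) (X1 X2 : 'M[R]_(r, n)) :
  continuous phi ->
  (forall X, realizations R M X -> phi X != 0) ->
  (forall (A : 'M[R]_r) X, A \in unitmx -> 0 < phi X -> 0 < phi (A *m X)) ->
  realizations R M X1 -> realizations R M X2 -> 0 < phi X1 -> phi X2 < 0 ->
  ~ connected [set: realization_space R M].
Proof.
move=> phi_cont phi_neq0 phi_equiv MX1 MX2 phiX1 phiX2 conn.
pose Q := realization_space R M.
pose psi (X : realizations R M) := phi (\val X).
have psi_cont : continuous psi.
  move=> X; apply: continuous_comp; first exact: initial_continuous.
  exact: phi_cont.
have psi_neq0 X : psi X != 0 by apply: phi_neq0; exact: set_valP.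
(* [phi_equiv] is only an implication, so the equivalence is used in both directions. *)
have psi_repr X : (0 < psi (repr (\pi_Q X)%qT)) = (0 < psi X).
  have /eqmodP XE : (repr (\pi_Q X) = X
      %[mod {eq_quot linear_equivalence R M}])%qT by exact: (@reprK _ Q).
  have YE : linearly_equivalent X (repr (\pi_Q X)%qT).
    by rewrite linearly_equivalent_sym.
  move: XE YE => /asboolP[A uA XE] /asboolP[B uB YE].
  by apply/idP/idP => psi_gt0; [rewrite /psi XE|rewrite /psi YE];
    exact: phi_equiv.
pose U : set Q := [set q | 0 < psi (repr q)].
(* In the quotient topology, openness is by definition openness of the preimage. *)
have open_pi (A : set Q) (B : set (realizations R M)) :
    (\pi_Q)%qT @^-1` A = B -> open B -> open A by move=> <-.
have openU : open U.
  have preimU : (\pi_Q)%qT @^-1` U = psi @^-1` [set x | 0 < x].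
    by apply/seteqP; split => X; rewrite /U /= psi_repr.
  apply: (open_pi _ _ preimU).
  by move/continuousP: psi_cont; apply; exact: open_gt.
have closedU : closed U.
  rewrite -[U]setCK; apply: open_closedC.
  have preimUC : (\pi_Q)%qT @^-1` (~` U) = psi @^-1` [set x | x < 0].
    apply/seteqP; split => X; rewrite /U /= psi_repr.
      by move/negP; rewrite -leNgt le_eqVlt (negbTE (psi_neq0 X)).
    by move=> psi_lt0; apply/negP; rewrite -leNgt ltW.
  apply: (open_pi _ _ preimUC).
  by move/continuousP: psi_cont; apply; exact: open_lt.
pose Y1 : realizations R M := exist _ X1 (mem_set MX1).
pose Y2 : realizations R M := exist _ X2 (mem_set MX2).
have UT : U = [set: Q].
  apply: conn.
  - by exists (\pi_Q Y1)%qT; rewrite /U /= psi_repr.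
  - by exists U; rewrite ?setTI.
  - by exists U; rewrite ?setTI.
have : U (\pi_Q Y2)%qT by rewrite UT.
by rewrite /U /= psi_repr ltNge ltW.
Qed.

(** * Two realizations *)

Lemma sgz_int_of_Z (x : Z) : sgz (int_of_Z x) = int_of_Z (Z.sgn x).
Proof. by case: x => //= p; have [n ->] := Pos2Nat.is_succ p. Qed.

Definition point (s : seq (Z * Z * Z)) (j : 'I_13) := nth (0, 0, 0) s j.

(* Binary integers, for which the 13^3 brackets can be computed. *)
Definition bracketZ (s : seq (Z * Z * Z)) (i j k : 'I_13) : Z :=
  let: (x0, x1, x2) := point s i in
  let: (y0, y1, y2) := point s j in
  let: (z0, z1, z2) := point s k in
  x0 * (y1 * z2 - y2 * z1) - x1 * (y0 * z2 - y2 * z0) + x2 * (y0 * z1 - y1 * z0).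

Definition point_mx (R : realType) (s : seq (Z * Z * Z)) : 'M[R]_(3, 13) :=
  \matrix_(r, j)
    (int_of_Z (let: (x, y, z) := point s j in [:: x; y; z]`_r))%:~R.

Lemma bracket_point_mx (R : realType) s i j k :
  bracket (point_mx R s) i j k = (int_of_Z (bracketZ s i j k))%:~R.
Proof.
rewrite /bracket !mxE /bracketZ.
case: (point s i) => [[? ?] ?]; case: (point s j) => [[? ?] ?].
by case: (point s k) => [[? ?] ?]; rewrite /= !(rmorphD, rmorphN, rmorphM).
Qed.

Lemma separator_point_mx (R : realType) s :
  separator (point_mx R s) = (int_of_Z (separator_of (bracketZ s)))%:~R.
Proof.
rewrite -!separator_of_rmorph /separator; congr separator_of.
apply/funext => i; apply/funext => j; apply/funext => k.
exact: bracket_point_mx.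
Qed.

(* (s, t, u, v) = (3, 1/13, 1/2, 1), up to positive rescaling of the columns *)
Definition negative_points : seq (Z * Z * Z) :=
  [:: (1, 0, 0); (0, 1, 0); (0, 0, 1); (1, 1, 1); (1, 1, 4); (2, 3, 2);
      (13, 13, 14); (26, 13, 14); (26, 13, 30); (13, 0, -22);
      (78, 39, -62); (37, 11, 0); (42, 81, 182)]%Z.

(* (s, t, u, v) = (3, 1/3, 2/3, 1), up to positive rescaling of the columns *)
Definition positive_points : seq (Z * Z * Z) :=
  [:: (1, 0, 0); (0, 1, 0); (0, 0, 1); (1, 1, 1); (1, 1, 4); (3, 5, 3);
      (3, 3, 4); (6, 3, 4); (12, 6, 19); (6, 0, -5);
      (60, 30, -17); (29, 5, 0); (303, 693, 1304)]%Z.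

(** An explicit list, over which [vm_compute] can check all triples. *)
Definition ordinals13 : seq 'I_13 :=
  [:: 'p_0; 'p_1; 'p_2; 'p_3; 'p_4; 'p_5; 'p_6; 'p_7; 'p_8; 'p_9; 'p_10; 'p_11;
      'p_12].

Lemma mem_ordinals13 i : i \in ordinals13.
Proof.
by rewrite -(mem_map val_inj); case: i => -[|[|[|[|[|[|[|[|[|[|[|[|[|]]]]]]]]]]]]].
Qed.

Lemma same_orientation i j k :
  Z.sgn (bracketZ positive_points i j k) =
  Z.sgn (bracketZ negative_points i j k).
Proof.
have : all (fun i => all (fun j => all (fun k =>
    Z.eqb (Z.sgn (bracketZ positive_points i j k))
          (Z.sgn (bracketZ negative_points i j k)))
    ordinals13) ordinals13) ordinals13 by vm_compute.
move=> /allP/(_ _ (mem_ordinals13 i))/allP/(_ _ (mem_ordinals13 j)).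
by move=> /allP/(_ _ (mem_ordinals13 k))/Z.eqb_eq.
Qed.

Lemma same_chirotope (R : realType) :
  chirotope_mx (point_mx R positive_points) =1
  chirotope_mx (point_mx R negative_points).
Proof.
by move=> i; rewrite !chirotope_mxE !bracket_point_mx !sgz_int !sgz_int_of_Z
  same_orientation.
Qed.

Lemma negative_points_incidences :
  all (fun T => bracketZ negative_points T.1.1 T.1.2 T.2 == 0) incidences.
Proof. by vm_compute. Qed.

Lemma negative_points_bases :
  all (fun T => bracketZ negative_points T.1.1 T.1.2 T.2 != 0) bases.
Proof. by vm_compute. Qed.

Theorem theorem1p3 (R : realType) :
  exists M : oriented_matroid 3 13, ~ connected [set: realization_space R M].
Proof.
pose Xn := point_mx R negative_points; pose Xp := point_mx R positive_points.
have frame_n : bracket Xn 'p_0 'p_1 'p_2 != 0.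
  by rewrite bracket_point_mx intr_eq0; vm_compute.
have frame_p : bracket Xp 'p_0 'p_1 'p_2 != 0.
  by rewrite bracket_point_mx intr_eq0; vm_compute.
pose idx (i j k : 'I_13) := [ffun r : 'I_3 => [:: i; j; k]`_r].
have chi_idx (X : 'M[R]_(3, 13)) i j k :
    chirotope_mx X (idx i j k) = sgz (bracket X i j k).
  by rewrite chirotope_mxE !ffunE.
have Xn_neq0 : exists i, chirotope_mx Xn i != 0.
  by exists (idx 'p_0 'p_1 'p_2); rewrite chi_idx sgz_eq0.
exists (vector_matroid Xn_neq0).
apply: (@realization_space_disconnected R 3 13 _ (@separator R) Xp Xn).
- exact: continuous_separator.
- move=> X [_ chiX].
  (* A realization has the chirotope of [Xn] up to a global sign, hence the same vanishing
     brackets. *)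
  have brX i j k :
      (bracket X i j k == 0) = (bracketZ negative_points i j k == 0).
    rewrite -sgz_eq0 -chi_idx.
    have -> : (chirotope_mx X (idx i j k) == 0) =
        (chirotope_mx Xn (idx i j k) == 0).
      by case: chiX => ->; rewrite ?oppr_eq0.
    by rewrite chi_idx sgz_eq0 bracket_point_mx intr_eq0 -(can_eq int_of_ZK).
  apply: separator_neq0 => T inT.
    by apply/eqP; rewrite brX; exact: (allP negative_points_incidences).
  by rewrite brX; exact: (allP negative_points_bases).
- move=> A X uA sep_gt0; rewrite separator_mulmx pmulr_rgt0 //.
  by rewrite exprn_even_gt0 //= -unitfE -unitmxE.
- by split; [exact: mxrank_bracket frame_p|left; exact: same_chirotope].
- by split; [exact: mxrank_bracket frame_n|left].
- by rewrite separator_point_mx ltr0z; vm_compute.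
- by rewrite separator_point_mx ltrz0; vm_compute.
Qed.
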